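(* Let $1<p<\infty$ and suppose that $f\in JN_p(\mathbb{R}^n)$. Then there is a constant $b$ such that $$\lim_{a\to\infty}\ \sup_{\substack{Q\subset\mathbb{R}^n\\ l(Q)\ge a}} |Q|^{1/p}\,\frac{1}{|Q|}\int_Q |f-b| = 0,$$ where the supremum is taken over all cubes $Q\subset\mathbb{R}^n$ such that the side length $l(Q)$ of $Q$ is at least $a$.
   Context: A cube means an open (bounded) cube in $\mathbb{R}^n$ with edges parallel to the coordinate axes; $l(Q)$ is its side length and $|Q|$ its Lebesgue measure. Write $f_Q=\frac{1}{|Q|}\int_Q f$. For $1<p<\infty$, a function $f$ is in $JN_p(\mathbb{R}^n)$ if $f\in L^1_{loc}(\mathbb{R}^n)$ and there is a constant $K<\infty$ such that $$\sum_{i=1}^\infty |Q_i|\left(\frac{1}{|Q_i|}\int_{Q_i}|f-f_{Q_i}|\right)^{p}\le K^p$$ for all countable collections of pairwise disjoint cubes $(Q_i)_{i=1}^\infty$ in $\mathbb{R}^n$. *)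

(* Defs.v *)
From HB Require Import structures.
From mathcomp Require Import all_boot all_order all_algebra.
From mathcomp Require Import all_classical all_reals all_analysis.

Set Implicit Arguments.
Unset Strict Implicit.
Unset Printing Implicit Defensive.
Import Order.TTheory GRing.Theory Num.Theory.
Import numFieldNormedType.Exports.

Local Open Scope classical_set_scope.
Local Open Scope ring_scope.

(** The n-fold product of the one-dimensional Lebesgue measure, on the product
    sigma-algebra of [n.-tuple R]. *)
Section product_lebesgue.
Variable R : realType.
Local Notation RT := (measurableTypeR R).

Definition tcons n (z : RT * n.-tuple RT) : n.+1.-tuple RT :=
  [tuple of z.1 :: z.2].

Lemma measurable_tcons n : measurable_fun setT (@tcons n).
Proof. by apply: measurable_cons. Qed.

Section successor.
Variables (n : nat) (m : {sigma_finite_measure set (n.-tuple RT) -> \bar R}).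

Definition lebesgue_cons : set (n.+1.-tuple RT) -> \bar R :=
  pushforward (@lebesgue_measure R \x m)%E (@tcons n).

Let lc0 : lebesgue_cons set0 = 0%E.
Proof. by rewrite /lebesgue_cons /pushforward preimage_set0 measure0. Qed.

Let lc_ge0 A : (0 <= lebesgue_cons A)%E.
Proof. by rewrite /lebesgue_cons /pushforward measure_ge0. Qed.

Let lc_sigma_additive : semi_sigma_additive lebesgue_cons.
Proof.
move=> F mF tF mUF; rewrite /lebesgue_cons /pushforward preimage_bigcup.
apply: measure_semi_sigma_additive.
- by move=> k; rewrite -[X in measurable X]setTI; exact: measurable_tcons.
- apply/trivIsetP => /= i j _ _ ij; rewrite -preimage_setI.
  by move/trivIsetP : tF => /(_ _ _ _ _ ij) ->//; rewrite preimage_set0.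
- by rewrite -preimage_bigcup -[X in measurable X]setTI; exact: measurable_tcons.
Qed.

HB.instance Definition _ := isMeasure.Build _ _ _
  lebesgue_cons lc0 lc_ge0 lc_sigma_additive.

Definition consX (A : set RT) (B : set (n.-tuple RT)) : set (n.+1.-tuple RT) :=
  [set t | A (tnth t ord0) /\ B [tuple tnth t (lift ord0 i) | i < n]].

Lemma preimage_tcons (A : set RT) (B : set (n.-tuple RT)) :
  @tcons n @^-1` consX A B = A `*` B.
Proof.
have E x t : [tuple tnth (tcons (x, t)) (lift ord0 i) | i < n] = t.
  by apply: eq_from_tnth => i; rewrite tnth_mktuple tnthS.
by apply/seteqP; split => -[x t]; rewrite /consX /= E.
Qed.

Lemma measurable_consX (A : set RT) (B : set (n.-tuple RT)) :
  measurable A -> measurable B -> measurable (consX A B).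
Proof.
move=> mA mB.
have mt : measurable_fun setT
    (fun t : n.+1.-tuple RT => [tuple tnth t (lift ord0 i) | i < n]).
  apply/measurable_fun_tnthP => i.
  rewrite (_ : _ \o _ = fun t : n.+1.-tuple RT => tnth t (lift ord0 i)).
    exact: measurable_tnth.
  by apply/funext => t /=; rewrite tnth_mktuple.
have := measurableI _ _ (measurable_tnth ord0 measurableT mA)
  (mt measurableT _ mB).
by rewrite !setTI.
Qed.

Lemma lebesgue_consX (A : set RT) (B : set (n.-tuple RT)) :
  measurable A -> measurable B ->
  lebesgue_cons (consX A B) = (lebesgue_measure A * m B)%E.
Proof.
move=> mA mB.
by rewrite /lebesgue_cons /pushforward preimage_tcons product_measure1E.
Qed.

Let lc_sigma_finite : sigma_finite setT lebesgue_cons.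
Proof.
have /sigma_finiteP[F [TF ndF Foo]] := sigma_finiteT (@lebesgue_measure R).
have /sigma_finiteP[G [TG ndG Goo]] := sigma_finiteT m.
exists (fun k => consX (F k) (G k)).
  apply/esym; rewrite -subTset => t _.
  have [i _ Fi] : (\bigcup_i F i) (tnth t ord0) by rewrite -TF.
  have [j _ Gj] : (\bigcup_i G i) [tuple tnth t (lift ord0 i) | i < n]
    by rewrite -TG.
  exists (maxn i j) => //; split.
    by move: Fi; exact/subsetPset/ndF/leq_maxl.
  by move: Gj; exact/subsetPset/ndG/leq_maxr.
move=> k; have [? ?] := Foo k; have [? ?] := Goo k.
split; first exact: measurable_consX.
by rewrite lebesgue_consX// lte_mul_pinfty// ge0_fin_numE.
Qed.

HB.instance Definition _ := Measure_isSigmaFinite.Build _ _ _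
  lebesgue_cons lc_sigma_finite.

End successor.

Fixpoint lebesgue_tuple n :
    {sigma_finite_measure set (n.-tuple RT) -> \bar R} :=
  match n with
  | 0 => \d_([tuple] : 0.-tuple RT)
  | k.+1 => lebesgue_cons (lebesgue_tuple k)
  end.

End product_lebesgue.

Lemma measurable_box (R : realType) n (A : 'I_n -> set (measurableTypeR R)) :
  (forall i, measurable (A i)) ->
  measurable [set t : n.-tuple (measurableTypeR R) | forall i, A i (tnth t i)].
Proof.
move=> mA; rewrite (_ : mkset _ = \bigcap_(i in [set: 'I_n])
    ((fun t : n.-tuple (measurableTypeR R) => tnth t i) @^-1` A i)).
  apply: fin_bigcap_measurable => [|i _]; first exact: finite_finset.
  by rewrite -[X in measurable X]setTI; exact: measurable_tnth.
by apply/seteqP; split => t /= At i; [move=> _|]; exact: At.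
Qed.

Lemma lebesgue_tuple_box (R : realType) n
    (A : 'I_n -> set (measurableTypeR R)) :
  (forall i, measurable (A i)) ->
  lebesgue_tuple R n [set t | forall i, A i (tnth t i)] =
  (\prod_(i < n) lebesgue_measure (A i))%E.
Proof.
elim: n A => [|n IH] A mA.
  by rewrite big_ord0 /= diracE mem_set// => -[].
have mB := measurable_box (fun i => mA (lift ord0 i)).
rewrite big_ord_recl -IH//.
rewrite -(lebesgue_consX (lebesgue_tuple R n) (mA ord0) mB).
congr (lebesgue_cons _ _); apply/seteqP; split => t /=.
  by move=> At; split=> [|i]; [exact: At|rewrite tnth_mktuple; exact: At].
move=> [A0 At] i; have [j ->|->//] := unliftP ord0 i.
by have := At j; rewrite tnth_mktuple.
Qed.

(** [lebesgue_outer] is the Lebesgue outer measure on R^n; Caratheodory's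
    construction then gives the Lebesgue sigma-algebra, which is complete, so
    that measurable functions need not be Borel. *)
Section lebesgue_rV.
Variables (R : realType) (n : nat).
Local Open Scope ereal_scope.

Definition tuples (A : set 'rV[R]_n) : set (n.-tuple (measurableTypeR R)) :=
  [set t | A (\row_i tnth t i)%R].

Definition lebesgue_outer (A : set 'rV[R]_n) : \bar R :=
  mu_ext (lebesgue_tuple R n) (tuples A).

Let lo0 : lebesgue_outer set0 = 0.
Proof. exact: (outer_measure0 (mu_ext (lebesgue_tuple R n))). Qed.

Let lo_ge0 A : 0 <= lebesgue_outer A.
Proof. exact: outer_measure_ge0. Qed.

Let le_lo : {homo lebesgue_outer : A B / A `<=` B >-> A <= B}.
Proof. by move=> A B AB; apply: le_outer_measure => t; exact: AB. Qed.

Let lo_sigma_subadditive : sigma_subadditive lebesgue_outer.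
Proof. by move=> F; exact: outer_measure_sigma_subadditive. Qed.

HB.instance Definition _ := isOuterMeasure.Build R 'rV[R]_n lebesgue_outer
  lo0 lo_ge0 le_lo lo_sigma_subadditive.

Definition lebesgue_rV :
    set (caratheodory_type lebesgue_outer) -> \bar R := lebesgue_outer.

Let lm_sigma_additive : semi_sigma_additive lebesgue_rV.
Proof.
move=> F mF tF mUF; rewrite /lebesgue_rV.
exact: caratheodory_measure_sigma_additive.
Qed.

HB.instance Definition _ := isMeasure.Build _ _ _ lebesgue_rV
  lo0 lo_ge0 lm_sigma_additive.

End lebesgue_rV.

Section JohnNirenberg.
Variables (R : realType) (n : nat).
Local Notation mu := (lebesgue_rV (R := R) (n := n)).

(** The open cube with lower corner [c] and side length [l]. *)
Definition cube (c : 'rV[R]_n) (l : R) : set 'rV[R]_n :=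
  [set x | forall i, c 0 i < x 0 i < c 0 i + l].

Let tuples_cube c l : tuples (cube c l) =
  [set t | forall i, `]c 0 i, c 0 i + l[%classic (tnth t i)].
Proof.
apply/seteqP; split => t /= ct i; have := ct i; rewrite ?mxE in_itv//.
Qed.

Let measurable_tuples_cube c l : measurable (tuples (cube c l)).
Proof.
rewrite tuples_cube.
by apply: (@measurable_box R n (fun i => `]c 0 i, c 0 i + l[%classic)).
Qed.

Lemma measurable_cube c l :
  measurable (cube c l : set (caratheodory_type (@lebesgue_outer R n))).
Proof.
move=> X.
exact: (caratheodory_measurable_mu_ext (lebesgue_tuple R n)
  (measurable_tuples_cube c l) (tuples X)).
Qed.

Lemma lebesgue_rV_cube c l : 0 <= l -> mu (cube c l) = (l ^+ n)%:E.
Proof.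
move=> l0; rewrite /lebesgue_rV /lebesgue_outer.
rewrite (measurable_mu_extE _ (measurable_tuples_cube c l)) tuples_cube.
have /= -> := @lebesgue_tuple_box R n (fun i => `]c 0 i, c 0 i + l[%classic)
  (fun i => measurable_itv _).
under eq_bigr do rewrite lebesgue_measure_itv/= lte_fin -EFinB addrAC subrr add0r.
rewrite -[X in (_ ^+ X)%R](card_ord n) -prodr_const -prodEFin.
apply: eq_bigr => i _; case: ifPn => //.
by rewrite ltrDl -leNgt => l0'; congr EFin; apply/le_anti; rewrite l0 l0'.
Qed.

Definition vol (Q : set 'rV[R]_n) : R := fine (mu Q).

(** No junk value arises from [fine] or from the real-valued integral when [Q]
    is a cube and [g] is locally integrable. *)
Definition mean (Q : set 'rV[R]_n) (g : 'rV[R]_n -> R) : R :=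
  (vol Q)^-1 * \int[mu]_(x in Q) g x.

Definition locally_integrable_rV (f : 'rV[R]_n -> R) : Prop :=
  measurable_fun [set: caratheodory_type (@lebesgue_outer R n)] f /\
  forall K : set 'rV[R]_n, compact K -> (\int[mu]_(x in K) `|f x|%:E < +oo)%E.

(** [0 <= K] excludes the convention [K `^ p = 1] for [K < 0]. *)
Definition JN (p : R) (f : 'rV[R]_n -> R) : Prop :=
  locally_integrable_rV f /\
  exists2 K : R, 0 <= K &
    forall (c : nat -> 'rV[R]_n) (l : nat -> R),
      let Q i := cube (c i) (l i) in
      (forall i, 0 < l i) -> trivIset setT Q ->
      (\sum_(0 <= i <oo)
        (vol (Q i) * mean (Q i) (fun x => `|f x - mean (Q i) f|) `^ p)%:E
       <= (K `^ p)%:E)%E.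

End JohnNirenberg.

(* Main.v *)
Require Import Defs.
From mathcomp Require Import all_boot all_order all_algebra.
From mathcomp Require Import all_classical all_reals all_analysis.
From mathcomp Require Import measurable_realfun ring lra.
Import Order.TTheory GRing.Theory Num.Theory.
Import numFieldNormedType.Exports.
Local Open Scope classical_set_scope.
Local Open Scope ring_scope.

(** Write [O(Q)] for the mean oscillation of [f] over a cube [Q] and [f_Q] for
    its mean.  The [JN_p] condition bounds [|Q| O(Q)^p], summed over disjoint
    cubes, so [O(Q) <= K |Q|^(-1/p)] for every single cube.  The proof improves
    [K] to an arbitrarily small constant for the cubes that lie in
    a half-space far from the origin, and then covers every cube by one fixed cube
    and [2n] such cubes of its own size.

    _Far cubes oscillate little_ ([JN_osc_far]).  If, however large [M] is, some
    cube on which one coordinate exceeds [M] in absolute value violates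
    [O(Q) <= e |Q|^(-1/p)], then such cubes can be picked one after the other,
    each beyond all the previous ones.  They are disjoint and each contributes
    more than [e^p] to the [JN_p] sum, which is bounded.

    _The constant_ ([limit_mean]).  If the cubes [R_k] are nested and double in
    size, then [|f_(R_k) - f_(R_(k+1))| <= 2^n O(R_(k+1))] decays geometrically;
    so [f_(R_k)] converges, and the distance from [f_(R_0)] to the limit is
    controlled by the bound on the oscillations times [|R_0|^(-1/p)].  The limit
    does not depend on the sequence: the cubes of any sequence used here lie in
    proportionally larger cubes of one sequence with centre fixed near the origin,
    so that the means over both differ by a multiple of the oscillation over the
    larger cube, which tends to [0].  This common limit is [b].  A
    cube lying in a half-space away from the origin can be doubled inside that
    half-space, so the small oscillation bound holds along the whole sequence,
    and the mean of [|f - b|] over a far cube is at most [e |Q|^(-1/p)]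
    ([mean_dist_far]).

    _All large cubes_ ([mean_dist_cover]).  A point of [Q] outside the fixed cube
    [B] of side [2 (M + 1)] centred at [0] has a coordinate greater than [M] or
    less than [-M].  The part of [Q] where the [i]-th coordinate exceeds [M] fits
    in a cube as large as [Q] on which it exceeds [M], and likewise for [-M].
    Hence the integral of [|f - b|] over [Q] is at most its integral over [B] plus
    [2n e |Q|^(1 - 1/p)].  After multiplication by [|Q|^(1/p - 1)] the second
    term is [2n e], and the first tends to [0] as [|Q|] grows because [p > 1]. *)

(** * Integrals and means over cubes *)

(** The sets [F i] may overlap, so that open cubes can cover an open cube without
    any discussion of the null sets on their boundaries. *)
Lemma ge0_integral_le_cover d (X : measurableType d) (R : realType)
    (m : {measure set X -> \bar R}) (I : Type) (s : seq I) (F : I -> set X)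
    (A : set X) (g : X -> \bar R) :
  measurable A -> (forall i, measurable (F i)) ->
  measurable_fun setT g -> (forall x, 0 <= g x)%E ->
  A `<=` \big[setU/set0]_(i <- s) F i ->
  (\int[m]_(x in A) g x <= \sum_(i <- s) \int[m]_(x in F i) g x)%E.
Proof.
move=> + mF mg g0.
have mgS (B : set X) : measurable_fun B g.
  exact: (measurable_funS measurableT (@subsetT _ _) mg).
elim: s A => [|i s IH] A mA.
  by rewrite !big_nil subset0 => ->; rewrite integral_set0.
rewrite !big_cons => AF.
rewrite -(setUIDK A (F i)) ge0_integral_setU//; last first.
- by apply/disj_setPS => x [[_ +] [_]].
- exact: measurableD.
- exact: measurableI.
apply: leeD.
  by apply: ge0_subset_integral => //; exact: measurableI.
apply: IH; first exact: measurableD.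
by move=> x [/AF[]].
Qed.

Section means_over_cubes.
Variables (R : realType) (n : nat).
Local Notation mu := (lebesgue_rV (R := R) (n := n)).
Local Notation T := (caratheodory_type (@lebesgue_outer R n)).
Implicit Types (c : 'rV[R]_n) (l b : R) (f g : 'rV[R]_n -> R).

Lemma vol_cube c l : 0 <= l -> vol (cube c l) = l ^+ n.
Proof. by move=> l0; rewrite /vol lebesgue_rV_cube. Qed.

Lemma vol_cube_gt0 c l : 0 < l -> 0 < vol (cube c l).
Proof. by move=> l0; rewrite vol_cube ?ltW// exprn_gt0. Qed.

(** Local integrability controls integrals over compact sets only; an open cube
    is reached through this box. *)
Definition closed_box c l : set 'rV[R]_n :=
  [set x | forall i, `[c 0 i, c 0 i + l]%classic (x 0 i)].

Lemma measurable_closed_box c l : measurable (closed_box c l : set T).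
Proof.
have mt : measurable (tuples (closed_box c l)).
  rewrite (_ : tuples _ =
      [set t | forall i, `[c 0 i, c 0 i + l]%classic (tnth t i)]).
    exact: (@measurable_box R n (fun i => `[c 0 i, c 0 i + l]%classic)).
  by apply/seteqP; split => t /= ct i; have := ct i; rewrite mxE.
by move=> X; exact: (caratheodory_measurable_mu_ext (lebesgue_tuple R n) mt
  (tuples X)).
Qed.

Lemma integrable_cube f c l : locally_integrable_rV f ->
  mu.-integrable (cube c l : set T) (EFin \o f).
Proof.
move=> [mf Kf].
apply: (@integrableS _ _ _ mu (closed_box c l)).
- exact: measurable_closed_box.
- exact: measurable_cube.
- move=> x cx i; have /andP[h1 h2] := cx i.
  by rewrite /= in_itv/= !ltW.
apply/integrableP; split.
  apply/measurable_EFinP; exact: (measurable_funS measurableT (@subsetT _ _) mf).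
have /Kf : compact (closed_box c l).
  apply: (@rV_compact _ _ (fun i => `[c 0 i, c 0 i + l]%classic)) => i.
  exact: segment_compact.
exact.
Qed.

Lemma integrable_cst_cube b c l : 0 <= l ->
  mu.-integrable (cube c l : set T) (EFin \o cst b).
Proof.
move=> l0; apply/integrableP; split.
  by apply/measurable_EFinP; exact: measurable_cst.
rewrite (eq_integral (cst `|b|%:E))// integral_cst/=; last exact: measurable_cube.
by rewrite [X in (_ * X)%E]lebesgue_rV_cube// ltry.
Qed.

Lemma integrable_dist f b c l : locally_integrable_rV f -> 0 <= l ->
  mu.-integrable (cube c l : set T) (EFin \o (fun x => `|f x - b|)).
Proof.
move=> lf l0.
have mQ := measurable_cube c l.
rewrite (_ : _ \o _ = (fun x => `|(f x - b)%:E|%E)); last exact/funext.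
apply: integrable_abse.
rewrite (_ : (fun x => _) = (EFin \o f) \- (EFin \o cst b))%E; last exact/funext.
by apply: integrableB => //; [exact: integrable_cube|exact: integrable_cst_cube].
Qed.

Lemma mean_ge0 (Q : set 'rV[R]_n) g : (forall x, 0 <= g x) -> 0 <= mean Q g.
Proof.
move=> g0; rewrite mulr_ge0// ?invr_ge0; last exact: Rintegral_ge0.
by rewrite /vol fine_ge0// measure_ge0.
Qed.

Lemma mean_cst b c l : 0 < l -> mean (cube c l) (cst b) = b.
Proof.
move=> l0; rewrite /mean Rintegral_cst; last exact: measurable_cube.
by rewrite mulrCA -/(vol _) mulVf ?mulr1// gt_eqF// vol_cube_gt0.
Qed.

Lemma dist_mean_le f b c l : locally_integrable_rV f -> 0 < l ->
  `|mean (cube c l) f - b| <= mean (cube c l) (fun x => `|f x - b|).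
Proof.
move=> lf l0; have l0' := ltW l0.
have mQ := measurable_cube c l.
rewrite -{1}(mean_cst b c _ l0) /mean -mulrBr.
rewrite -RintegralB//; [|exact: integrable_cube|exact: integrable_cst_cube].
rewrite normrM ger0_norm ?invr_ge0 ?(ltW (vol_cube_gt0 _ _ _))//.
rewrite ler_pM2l ?invr_gt0 ?vol_cube_gt0//.
apply: le_normr_Rintegral => //.
rewrite (_ : _ \o _ = (EFin \o f) \- (EFin \o cst b))%E; last exact/funext.
by apply: integrableB => //; [exact: integrable_cube|exact: integrable_cst_cube].
Qed.

Lemma mean_dist_triangle f a b c l : locally_integrable_rV f -> 0 < l ->
  mean (cube c l) (fun x => `|f x - b|) <=
  mean (cube c l) (fun x => `|f x - a|) + `|a - b|.
Proof.
move=> lf l0; have l0' := ltW l0.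
have mQ := measurable_cube c l.
rewrite -[X in _ <= _ + X](mean_cst `|a - b| c _ l0) /mean -mulrDr.
rewrite ler_pM2l ?invr_gt0 ?vol_cube_gt0//.
rewrite -RintegralD//; [|exact: integrable_dist|exact: integrable_cst_cube].
apply: le_Rintegral => //; first exact: integrable_dist.
  rewrite (_ : _ \o _ =
      (EFin \o (fun x => `|f x - a|%R)) \+ (EFin \o cst `|a - b|%R))%E;
    last exact/funext.
  by apply: integrableD => //; [exact: integrable_dist|exact: integrable_cst_cube].
by move=> x _ /=; rewrite (le_trans _ (ler_normD _ _))// addrA subrK.
Qed.

End means_over_cubes.

(** * Geometric increments and powers of the volume *)

Lemma cvg_geometric_increments (R : realType) (u : nat -> R) (a q : R) :
  0 <= a -> 0 < q -> q < 1 ->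
  (forall k, `|u k.+1 - u k| <= a * q ^+ k) ->
  exists2 L : R, u @ \oo --> L & `|u 0%N - L| <= a / (1 - q).
Proof.
move=> a0 q0 q1 uq.
have q1' : `|q| < 1 by rewrite ger0_norm ?ltW.
have cu : cvgn (series (telescope u)).
  apply: normed_cvg; apply: (@series_le_cvg R _ (geometric a q)) => //=.
  - by move=> k; rewrite mulr_ge0 // exprn_ge0 // ltW.
  - exact: is_cvg_geometric_series.
have bu k : `|u k - u 0%N| <= a / (1 - q).
  have -> : u k - u 0%N = series (telescope u) k by rewrite telescopeK.
  rewrite (le_trans _ (@geometric_le_lim R k a q a0 q0 q1'))//.
  rewrite /series /= (le_trans (ler_norm_sum _ _ _))//.
  by apply: ler_sum => i _; exact: uq.
have {}cu : u @ \oo --> limn (series (telescope u)) + u 0%N.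
  have := cvgD cu (cvg_cst (u 0%N)).
  have -> : (series (telescope u) + (fun=> u 0%N)) = u.
    apply/funext => k; rewrite fctE telescopeK; exact: subrK.
  exact.
exists (limn (series (telescope u)) + u 0%N) => //.
apply: (@cvgr_to_le _ \oo _ R (fun k => `|u 0%N - u k|)).
  by apply: cvg_norm; apply: cvgB => //; exact: cvg_cst.
by apply: nearW => k; rewrite distrC.
Qed.

Section powers.
Variables (R : realType) (n : nat) (p : R).
Hypotheses (n0 : (0 < n)%N) (p0 : 0 < p).

(** [decay l] is [|Q|^(-1/p)] for a cube [Q] of side length [l]: the rate at which
    oscillations over cubes of a [JN p] function are bounded. *)
Definition decay (l : R) : R := (l ^+ n) `^ (- p^-1).

Lemma decay_gt0 l : 0 < l -> 0 < decay l.
Proof. by move=> l0; rewrite powR_gt0// exprn_gt0. Qed.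

Lemma decayM x y : 0 < x -> 0 < y -> decay (x * y) = decay x * decay y.
Proof. by move=> x0 y0; rewrite /decay exprMn powRM// exprn_ge0// ltW. Qed.

Lemma decayX x k : 0 < x -> decay (x ^+ k) = decay x ^+ k.
Proof.
move=> x0; elim: k => [|k IH].
  by rewrite !expr0 /decay expr1n powR1.
by rewrite !exprS decayM ?exprn_gt0// IH.
Qed.

(** Doubling a cube divides the oscillation bound by a fixed factor greater than
    [1], hence the geometric convergence of the means. *)
Lemma decay2_lt1 : decay 2 < 1.
Proof.
rewrite /decay powRN invf_lt1 ?powR_gt0 ?exprn_gt0//.
rewrite -[ltLHS](congr1 (fun g => g p^-1) (powR1 R)).
rewrite gt0_ltr_powR ?invr_gt0 ?nnegrE ?exprn_ge0//.
by rewrite exprn_egt1 ?ltr1n -?lt0n.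
Qed.

Lemma le_decay_of_energy (e o l : R) : 0 <= e -> 0 <= o -> 0 < l ->
  l ^+ n * o `^ p <= e `^ p -> o <= e * decay l.
Proof.
move=> e0 o0 l0 H.
have ln0 : 0 < l ^+ n by rewrite exprn_gt0.
have h : (l ^+ n * o `^ p) `^ p^-1 <= (e `^ p) `^ p^-1.
  by apply: ge0_ler_powR H; rewrite ?invr_ge0 ?nnegrE ?mulr_ge0 ?powR_ge0 ?ltW.
rewrite powRM ?powR_ge0 ?(ltW ln0)// in h.
rewrite -!powRrM mulfV ?gt_eqF// !powRr1// in h.
by rewrite /decay powRN ler_pdivlMr ?powR_gt0// mulrC.
Qed.

End powers.

Arguments decay {R}.

(** * Oscillation of a JN function *)

Section oscillation.
Variables (R : realType) (n : nat).
Local Notation mu := (lebesgue_rV (R := R) (n := n)).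
Local Notation T := (caratheodory_type (@lebesgue_outer R n)).
Implicit Types (c : 'rV[R]_n) (l b : R) (f g : 'rV[R]_n -> R).

Definition osc f c l : R :=
  mean (cube c l) (fun x => `|f x - mean (cube c l) f|).

Lemma osc_ge0 f c l : 0 <= osc f c l.
Proof. by apply: mean_ge0 => x. Qed.

Lemma integral_cubeE f b c l : locally_integrable_rV f -> 0 < l ->
  (\int[mu]_(x in cube c l) `|f x - b|%:E)%E =
  (l ^+ n * mean (cube c l) (fun x => `|f x - b|))%:E.
Proof.
move=> lf l0.
rewrite /mean vol_cube ?ltW// mulrA mulfV ?mul1r ?gt_eqF ?exprn_gt0//.
rewrite /Rintegral fineK//.
apply: integrable_fin_num; first exact: measurable_cube.
by apply: integrable_dist => //; exact: ltW.
Qed.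

Lemma measurable_dist f b : locally_integrable_rV f ->
  measurable_fun [set: T] (EFin \o (fun x => `|f x - b|)).
Proof.
move=> [mf _]; apply/measurable_EFinP.
have mB := measurable_funB mf (measurable_cst b).
exact: (measurableT_comp (@normr_measurable R setT) mB).
Qed.

(** The integral of a nonnegative function grows with the cube; the factor is the
    ratio of the two volumes. *)
Lemma mean_dist_sub f b c l c' l' : locally_integrable_rV f ->
  0 < l -> 0 < l' -> cube c l `<=` cube c' l' ->
  mean (cube c l) (fun x => `|f x - b|) <=
  (l' / l) ^+ n * mean (cube c' l') (fun x => `|f x - b|).
Proof.
move=> lf l0 l'0 QR.
rewrite expr_div_n mulrAC ler_pdivlMr ?exprn_gt0// mulrC -lee_fin.
rewrite -!integral_cubeE//.
have mR := measurable_cube c' l'.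
have mg : measurable_fun (cube c' l' : set T) (EFin \o (fun x => `|f x - b|)).
  exact: (measurable_funS measurableT (@subsetT _ _) (measurable_dist f b lf)).
by have := ge0_subset_integral mu (measurable_cube c l) mR mg
  (fun x _ => normr_ge0 (f x - b)) QR.
Qed.

Lemma mean_sub_le_osc f c l c' l' : locally_integrable_rV f ->
  0 < l -> 0 < l' -> cube c l `<=` cube c' l' ->
  `|mean (cube c l) f - mean (cube c' l') f| <= (l' / l) ^+ n * osc f c' l'.
Proof.
move=> lf l0 l'0 QR.
by apply: le_trans; [exact: dist_mean_le|exact: mean_dist_sub].
Qed.

(** The cube lies in one of the [2n] coordinate half-spaces at distance
    [M] from the origin.
    Half-spaces, and not the complement of a cube, because a cube can be doubled
    indefinitely inside a half-space. *)
Definition far (M : R) c l := exists i, M <= c 0 i \/ c 0 i + l <= - M.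

Section JN_functions.
Variables (p : R) (f : 'rV[R]_n -> R).
Hypotheses (n0 : (0 < n)%N) (p0 : 0 < p) (fJN : JN p f).

(** The [JN] condition for finite families, obtained from an infinite family by
    dropping a nonnegative tail. *)
Lemma JN_energy : exists2 K : R, 0 <= K &
  forall (c : nat -> 'rV[R]_n) (l : nat -> R), (forall i, 0 < l i) ->
    (forall i j, (i < j)%N ->
       cube (c i) (l i) `&` cube (c j) (l j) `<=` set0) ->
    forall m, \sum_(0 <= i < m) l i ^+ n * osc f (c i) (l i) `^ p <= K `^ p.
Proof.
have [lf [K K0 HK]] := fJN; exists K => // c l l0 disj m.
have tQ : trivIset setT (fun i => cube (c i) (l i)).
  apply/trivIsetP => i j _ _; rewrite neq_ltn => /orP[] ij; rewrite -subset0.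
    exact: disj.
  by rewrite setIC; exact: disj.
have := HK c l l0 tQ; rewrite -lee_fin -sumEFin; apply: le_trans.
under eq_bigr => i _ do rewrite -(vol_cube _ _ (c i) (l i) (ltW (l0 i))).
apply: nneseries_lim_ge => i _ _; rewrite lee_fin mulr_ge0 ?powR_ge0//.
by rewrite ltW// vol_cube_gt0.
Qed.

(** A single cube is the first term of an infinite family of disjoint translates. *)
Lemma JN_osc_le : exists2 K : R, 0 <= K &
  forall c l, 0 < l -> osc f c l <= K * decay n p l.
Proof.
have [K K0 HK] := JN_energy; exists K => // c l l0.
apply: le_decay_of_energy => //; first exact: osc_ge0.
pose d (i : nat) : 'rV[R]_n := c + const_mx (i%:R * l).
have disj i j : (i < j)%N -> cube (d i) l `&` cube (d j) l `<=` set0.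
  move=> ij x [xi xj].
  have /andP[_] := xi (Ordinal n0); have /andP[+ _] := xj (Ordinal n0).
  rewrite !mxE => h1 h2; have := lt_trans h1 h2.
  have ij1 : i%:R + 1 <= j%:R :> R by rewrite natr1 ler_nat.
  rewrite -addrA ltrD2l; apply/negP; rewrite -leNgt.
  by rewrite -{2}(mul1r l) -mulrDl ler_pM2r.
have := HK d (fun=> l) (fun=> l0) disj 1%N.
rewrite big_nat1.
have -> : d 0%N = c by apply/rowP => i; rewrite !mxE mul0r addr0.
exact.
Qed.

(** Otherwise bad cubes could be chosen recursively, each far beyond the previous
    ones, and their energies would add up to infinity. *)
Lemma JN_osc_far (e : R) : 0 < e ->
  exists2 M : R, 0 <= M &
    forall c l, 0 < l -> far M c l -> osc f c l <= e * decay n p l.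
Proof.
move=> e0; apply: contrapT => noM.
have /choice[F HF] : forall M : R, exists z : 'rV[R]_n * R, 0 <= M ->
    [/\ 0 < z.2, far M z.1 z.2 & e * decay n p z.2 < osc f z.1 z.2].
  move=> M; have [M0|M0] := ltP M 0; first by exists (0, 0).
  apply: contrapT => noz; apply: noM; exists M => //.
  move=> c l l0 Mcl; rewrite leNgt; apply/negP => H; apply: noz.
  by exists (c, l).
(* The coordinates of the points of the cube [z] are at most [N z] in absolute
   value, so a cube that is far for [M k.+1] avoids the cubes chosen before. *)
pose N (z : 'rV[R]_n * R) : R := \sum_i `|z.1 0 i| + z.2.
pose M := fix M k := if k is k'.+1 then M k' + N (F (M k')) else 0.
have M0 k : 0 <= M k.
  elim: k => //= k IH; rewrite addr_ge0// addr_ge0// ?sumr_ge0//.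
  by have [/ltW] := HF _ IH.
have Mle i j : (i <= j)%N -> M i <= M j.
  move=> /subnK <-; elim: (j - i)%N => //= k IH.
  rewrite (le_trans IH)// lerDl addr_ge0// ?sumr_ge0//.
  by have [/ltW] := HF _ (M0 (k + i)%N).
have [K K0 HK] := JN_energy.
have {}HK := HK (fun k => (F (M k)).1) (fun k => (F (M k)).2).
have l0 i : 0 < (F (M i)).2 by have [] := HF _ (M0 i).
have {}HK m : \sum_(0 <= i < m) e `^ p <= K `^ p.
  apply: le_trans (HK l0 _ m).
    apply: ler_sum => i _; have [li _ H] := HF _ (M0 i).
    rewrite leNgt; apply/negP => /ltW E.
    have := le_decay_of_energy R n p p0 _ _ _ (ltW e0) (osc_ge0 _ _ _) li E.
    by rewrite leNgt H.
  move=> i j ij x [xi xj].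
  have xM k : `|x 0 k| <= M i.+1.
    have /andP[h1 h2] := xi k.
    have h3 : `|(F (M i)).1 0 k| <= \sum_k `|(F (M i)).1 0 k|.
      by rewrite (bigD1 k)//= lerDl sumr_ge0.
    have := M0 i; move: h3; rewrite /= /N ler_norml !ler_norml => /andP[].
    by move: h1 h2; have := l0 i; lra.
  have [_ [k Mk] _] := HF _ (M0 j).
  have /andP[h1 h2] := xj k.
  have := xM k; rewrite ler_norml => /andP[]; have := Mle _ _ ij.
  by case: Mk; move: h1 h2; lra.
have ep0 : 0 < e `^ p by rewrite powR_gt0.
have := HK (Num.bound (K `^ p / e `^ p)).
rewrite sumr_const_nat subn0 -mulr_natl -ler_pdivlMr//.
by rewrite leNgt archi_boundP // divr_ge0 // powR_ge0.
Qed.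
End JN_functions.
End oscillation.

Arguments osc {R n}.
Arguments far {R n}.

(** * Doubling sequences of cubes and the limit mean *)

Section chains.
Variables (R : realType) (n : nat).
Implicit Types (c : 'rV[R]_n) (l th : R).

(** Lower corner of the [k]-th doubling of [cube c l], about the point that divides
    each edge in the proportion [th]: the lower corner for [th = 0], the upper one
    for [th = 1], the centre for [th = 1/2]. *)
Definition chain th c l (k : nat) : 'rV[R]_n :=
  c - const_mx (th * (2 ^+ k - 1) * l).

Lemma chain0 th c l : chain th c l 0 = c.
Proof. by rewrite /chain expr0 subrr mulr0 mul0r subr0. Qed.

Lemma chain_nested th c l k : 0 <= th <= 1 -> 0 < l ->
  cube (chain th c l k) (2 ^+ k * l) `<=`
  cube (chain th c l k.+1) (2 ^+ k.+1 * l).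
Proof.
move=> /andP[th0 th1] l0 x Qx i; have := Qx i; rewrite !mxE exprS.
set t := 2 ^+ k; have t0 : 0 < t by rewrite exprn_gt0.
have tl : 0 < t * l by rewrite mulr_gt0.
have h1 : 0 <= th * (t * l) by rewrite mulr_ge0// ltW.
have h2 : 0 <= (1 - th) * (t * l) by rewrite mulr_ge0 ?subr_ge0// ltW.
by move=> /andP[h3 h4]; apply/andP; split; lra.
Qed.

Lemma chain_far M th c l k : (th = 0 /\ exists i, M <= c 0 i) \/
    (th = 1 /\ exists i, c 0 i + l <= - M) ->
  far M (chain th c l k) (2 ^+ k * l).
Proof.
case=> -[-> [i Mi]]; exists i; rewrite !mxE; [left|right]; lra.
Qed.

(** Up to a fixed shift [m] of the index, the doublings of any cube are dominated
    by the centred doublings of the unit cube.  With [m] fixed the volume ratio of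
    the two cubes does not depend on [k], so that their means have the same
    limit. *)
Lemma chain_sub_centered th c l : 0 <= th <= 1 -> 0 < l ->
  exists m : nat, forall k,
    cube (chain th c l k) (2 ^+ k * l) `<=`
    cube (chain 2^-1 0 1 (k + m)) (2 ^+ (k + m) * 1).
Proof.
move=> /andP[th0 th1] l0.
pose B := 2 * (\sum_i `|c 0 i| + l) + 1.
have B0 : 0 <= B by rewrite addr_ge0// mulr_ge0// addr_ge0 ?sumr_ge0// ltW.
exists (Num.bound B) => k x Qx i; have := Qx i; rewrite !mxE.
have Bm : B <= 2 ^+ Num.bound B.
  rewrite (le_trans (ltW (archi_boundP B0)))// -natrX ler_nat.
  exact/ltnW/ltn_expl.
rewrite exprD; move: Bm; set s := 2 ^+ Num.bound B => Bs.
set t := 2 ^+ k; have t1 : 1 <= t by rewrite exprn_ege1// ler1n.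
have t0 : 0 < t by rewrite (lt_le_trans _ t1).
have tl : 0 < t * l by rewrite mulr_gt0.
have h1 : 0 <= th * (t * l) by rewrite mulr_ge0// ltW.
have h2 : 0 <= (1 - th) * (t * l) by rewrite mulr_ge0 ?subr_ge0// ltW.
have h5 : t * B <= t * s by rewrite ler_pM2l.
have hc : `|c 0 i| <= \sum_i `|c 0 i| by rewrite (bigD1 i)//= lerDl sumr_ge0.
have h6 : t * `|c 0 i| <= t * \sum_i `|c 0 i| by rewrite ler_pM2l.
have h7 : `|c 0 i| <= t * `|c 0 i| by rewrite ler_peMl.
have /andP[h8 h9] : - `|c 0 i| <= c 0 i <= `|c 0 i| by rewrite -ler_norml.
have h10 : 0 <= th * l by rewrite mulr_ge0// ltW.
have h11 : 0 <= (1 - th) * l by rewrite mulr_ge0 ?subr_ge0// ltW.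
have h12 : l <= t * l by rewrite ler_peMl// ltW.
have h13 : th * l <= th * (t * l) by rewrite ler_wpM2l.
have h14 : (1 - th) * l <= (1 - th) * (t * l) by rewrite ler_wpM2l ?subr_ge0.
rewrite /B !mulrDr mulr1 mulrCA (mulrCA t 2) in h5.
by move=> /andP[h3 h4]; apply/andP; split; lra.
Qed.

Section limit_mean.
Variables (p : R) (f : 'rV[R]_n -> R).
Hypotheses (n0 : (0 < n)%N) (p0 : 0 < p) (lf : locally_integrable_rV f).
Let q := decay n p (2 : R).
Let q0 : 0 < q. Proof. exact: decay_gt0. Qed.
Let q1 : q < 1. Proof. exact: decay2_lt1. Qed.
Let C : R := 2 ^+ n / (1 - q).

Lemma chain_mean_cvg th c l (e : R) : 0 <= th <= 1 -> 0 < l -> 0 <= e ->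
  (forall k, osc f (chain th c l k) (2 ^+ k * l) <=
     e * decay n p (2 ^+ k * l)) ->
  exists2 L : R, mean (cube (chain th c l k) (2 ^+ k * l)) f @[k --> \oo] --> L &
    `|mean (cube c l) f - L| <= C * e * decay n p l.
Proof.
move=> th01 l0 e0 H.
have d0 := decay_gt0 R n p _ l0.
have [||L uL bL] := cvg_geometric_increments R
    (fun k => mean (cube (chain th c l k) (2 ^+ k * l)) f)
    (2 ^+ n * e * decay n p l) q _ q0 q1.
- by rewrite !mulr_ge0 ?exprn_ge0// ltW.
- move=> k; rewrite distrC.
  have lk i : 0 < 2 ^+ i * l by rewrite mulr_gt0// exprn_gt0.
  have sub := chain_nested _ c _ k th01 l0.
  apply: le_trans; first exact: (mean_sub_le_osc _ _ _ _ _ _ _ _ _ _ sub).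
  have -> : 2 ^+ k.+1 * l / (2 ^+ k * l) = 2.
    by rewrite exprS -(mulrA 2) mulfK // gt_eqF.
  rewrite -!mulrA ler_wpM2l ?exprn_ge0//.
  apply: le_trans (H _) _; rewrite ler_wpM2l// decayM ?exprn_gt0// decayX//.
  rewrite mulrC ler_wpM2l ?(ltW d0)// exprS ler_piMl ?exprn_ge0 ?(ltW q0)//.
  exact: ltW.
exists L => //; move: bL; rewrite chain0 expr0 mul1r.
by have -> : 2 ^+ n * e * decay n p l / (1 - q) = C * e * decay n p l
  by rewrite /C; ring.
Qed.

(** The same [b] serves for all the chains, with an error proportional to the
    oscillation bound [e] of the chain at hand and not to the global bound [K]:
    the increments along a chain bound the distance to its own limit, and [K] only
    serves to identify that limit. *)
Lemma limit_mean (K : R) : 0 <= K ->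
  (forall c l, 0 < l -> osc f c l <= K * decay n p l) ->
  exists b, forall th c l (e : R), 0 <= th <= 1 -> 0 < l -> 0 <= e ->
    (forall k, osc f (chain th c l k) (2 ^+ k * l) <=
       e * decay n p (2 ^+ k * l)) ->
    `|mean (cube c l) f - b| <= C * e * decay n p l.
Proof.
move=> K0 HK.
have p2 k : 0 < 2 ^+ k :> R by rewrite exprn_gt0.
have half01 : 0 <= (2^-1 : R) <= 1 by lra.
have [|b cb _] := @chain_mean_cvg 2^-1 0 1 K half01 ltr01 K0.
  by move=> k; apply: HK; rewrite mulr1.
exists b => th c l e th01 l0 e0 H.
have [L cL bL] := chain_mean_cvg _ _ _ _ th01 l0 e0 H.
suff -> : b = L by [].
have [m sub] := chain_sub_centered th c l th01 l0.
pose u k := mean (cube (chain th c l k) (2 ^+ k * l)) f.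
pose v k := mean (cube (chain 2^-1 0 1 k) (2 ^+ k * 1)) f.
have cv : v (k + m)%N @[k --> \oo] --> b by rewrite (cvg_shiftn m v).
have cuv : u k - v (k + m)%N @[k --> \oo] --> L - b by apply: cvgB.
apply/esym/eqP; rewrite -subr_eq0; apply/eqP.
apply: (@cvg_unique _ _ _ _ _ _ cuv) => //.
(* [D] is the fixed volume ratio times the oscillation bound at step [m]. *)
pose D := (2 ^+ m / l) ^+ n * (K * q ^+ m).
apply: norm_cvg0; apply: (@squeeze_cvgr _ _ _ _ (cst 0) (geometric D q)).
- apply: nearW => k; rewrite normr_ge0/=.
  apply: le_trans.
    apply: (mean_sub_le_osc _ _ _ _ _ _ _ _ _ _ (sub k)) => //; rewrite mulr_gt0//.
  have -> : 2 ^+ (k + m) * 1 / (2 ^+ k * l) = 2 ^+ m / l.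
    by rewrite mulr1 exprD invfM mulrACA mulfV ?mul1r// gt_eqF.
  rewrite /D -!mulrA ler_wpM2l ?exprn_ge0 ?divr_ge0 ?(ltW (p2 _)) ?(ltW l0)//.
  apply: le_trans (HK _ _ _) _; first by rewrite mulr1.
  by rewrite mulr1 decayX// -exprD addnC.
- exact: cvg_cst.
- by apply: cvg_geometric; rewrite ger0_norm ?(ltW q0).
Qed.

End limit_mean.
End chains.

Arguments chain {R n}.

(** * Covering a cube and the theorem *)

(** A far cube stays far along the chain that doubles it away from the origin, so
    its mean differs from [b] by no more than a multiple of the small bound valid
    for the oscillations over far cubes. *)
Lemma mean_dist_far (R : realType) (n : nat) (p : R) (f : 'rV[R]_n -> R) :
  (0 < n)%N -> 0 < p -> JN p f ->
  exists b : R, forall e : R, 0 < e -> exists2 M : R, 0 <= M &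
    forall c l, 0 < l -> far M c l ->
      mean (cube c l) (fun x => `|f x - b|) <= e * decay n p l.
Proof.
move=> n0 p0 fJN; have [lf _] := fJN.
have [K K0 HK] := JN_osc_le R n p f n0 p0 fJN.
have [b Hb] := limit_mean R n p f n0 p0 lf K K0 HK.
exists b => e e0.
set C := 2 ^+ n / _ in Hb.
have C1 : 0 < 1 + C.
  rewrite ltr_wpDr// divr_ge0 ?exprn_ge0// subr_ge0 ltW//.
  exact: decay2_lt1.
have e'0 : 0 < e / (1 + C) by rewrite divr_gt0.
have [M M0 HM] := JN_osc_far R n p f p0 fJN _ e'0.
exists M => // c l l0 Mcl.
apply: le_trans; first exact: (mean_dist_triangle _ _ f (mean (cube c l) f)).
suff H : `|mean (cube c l) f - b| <= C * (e / (1 + C)) * decay n p l.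
  apply: (le_trans (lerD (HM _ _ l0 Mcl) H)).
  rewrite -mulrDl -{1}(mul1r (e / _)) -mulrDl mulrCA mulfV ?mulr1//.
  by rewrite gt_eqF.
have lk k : 0 < 2 ^+ k * l by rewrite mulr_gt0// exprn_gt0.
(* A cube above [M] is doubled upwards, one below [- M] downwards. *)
have [i [Mi|Mi]] := Mcl.
  apply: (Hb 0) => //; rewrite ?lexx ?ler01 ?(ltW e'0)// => k.
  by apply: HM => //; apply: chain_far; left; split=> //; exists i.
apply: (Hb 1) => //; rewrite ?lexx ?ler01 ?(ltW e'0)// => k.
by apply: HM => //; apply: chain_far; right; split=> //; exists i.
Qed.

(** Pushing [cube c l] along the [i]-th axis just until it lies beyond [M], or
    below [- M], keeps all its points that were already there. *)
Lemma cube_cover_far (R : realType) (n : nat) (M : R) (c : 'rV[R]_n) (l : R) :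
  0 < l -> exists t : seq 'rV[R]_n,
  [/\ size t = (n * 2)%N, {in t, forall d, far M d l} &
    cube c l `<=` cube (const_mx (- (M + 1))) (2 * (M + 1)) `|`
                  \bigcup_(d in [set` t]) cube d l].
Proof.
move=> l0.
(* [m i s] is the [i]-th coordinate of the corner of the pushed cube. *)
pose m (i : 'I_n) (s : bool) :=
  if s then Num.max M (c 0 i) else Num.min (- M - l) (c 0 i).
pose w i s : 'rV[R]_n := \row_j if j == i then m i s else c 0 j.
pose t := [seq w i s | i <- enum 'I_n, s <- [:: true; false]].
have wt i s : w i s \in t.
  by apply: allpairs_f; rewrite ?mem_enum//; case: s.
exists t; split.
- by rewrite size_allpairs/= size_enum_ord.
- move=> _ /allpairsP[[i s] /= [_ _ ->]]; exists i; rewrite mxE eqxx.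
  case: s => /=; [left|right]; first by rewrite le_max lexx.
  by rewrite -lerBrDr ge_min lexx.
move=> x Qx; have [[i Mi]|noi] := pselect (exists i, M < `|x 0 i|).
  right; exists (w i (0 < x 0 i)); first exact: wt.
  move=> j; have /andP[h1 h2] := Qx j; rewrite mxE; case: eqP => [ji|_]; last first.
    by rewrite h1.
  subst j; rewrite /m; move: Mi; case: (ltP 0 (x 0 i)) => xi.
    rewrite gtr0_norm// => Mi.
    by case: (leP M (c 0 i)) => h3; apply/andP; split; lra.
  rewrite ler0_norm// => Mi.
  by case: (leP (- M - l) (c 0 i)) => h3; apply/andP; split; lra.
left=> i; rewrite mxE.
have : `|x 0 i| <= M by rewrite leNgt; apply/negP => Mi; apply: noi; exists i.
by rewrite ler_norml => /andP[h1 h2]; apply/andP; split; lra.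
Qed.

(** The [n * 2] far cubes of the covering have the volume of [cube c l], and the
    remaining cube does not depend on [c] and [l]. *)
Lemma mean_dist_cover (R : realType) (n : nat) (f : 'rV[R]_n -> R) (b M : R)
    (c : 'rV[R]_n) (l a : R) : locally_integrable_rV f -> 0 <= M -> 0 < l ->
  (forall d, far M d l -> mean (cube d l) (fun x => `|f x - b|) <= a) ->
  l ^+ n * mean (cube c l) (fun x => `|f x - b|) <=
  (2 * (M + 1)) ^+ n *
    mean (cube (const_mx (- (M + 1))) (2 * (M + 1))) (fun x => `|f x - b|) +
  (n * 2)%:R * (l ^+ n * a).
Proof.
move=> lf M0 l0 Ha.
have [t [st tfar Qt]] := cube_cover_far R n M c l l0.
have M1 : 0 < 2 * (M + 1) by lra.
have mg := measurable_dist R n f b lf.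
pose F (z : 'rV[R]_n * R) := cube z.1 z.2.
pose s := (const_mx (- (M + 1)), 2 * (M + 1)) :: [seq (d, l) | d <- t].
have mF z : measurable (F z : set (caratheodory_type (@lebesgue_outer R n))).
  exact: measurable_cube.
have Qs : F (c, l) `<=` \big[setU/set0]_(z <- s) F z.
  rewrite /s big_cons big_map -bigcup_seq; exact: Qt.
have := ge0_integral_le_cover _ _ R (lebesgue_rV (R := R) (n := n)) _ s F
  (F (c, l)) _ (mF (c, l)) mF mg (fun x => normr_ge0 (f x - b)) Qs.
rewrite /s big_cons big_map /F /=.
rewrite !integral_cubeE//.
under eq_bigr do rewrite integral_cubeE//.
rewrite sumEFin -EFinD lee_fin => /le_trans; apply.
rewrite lerD2l -st mulr_natl.
have <- : \sum_(d <- t) l ^+ n * a = (l ^+ n * a) *+ size t.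
  by rewrite big_const_seq iter_addr_0 count_predT.
rewrite big_seq [leRHS]big_seq; apply: ler_sum => d dt.
by rewrite ler_wpM2l ?exprn_ge0 ?(ltW l0)//; exact/Ha/tfar.
Qed.

(** The side length is chosen so that the integral over the fixed cube, divided by
    [|Q|^(1 - 1/p)], is at most [e / 2]; the far cubes account for the rest. *)
Lemma sup_mean_dist_small (R : realType) (n : nat) (p : R)
    (f : 'rV[R]_n -> R) :
  (0 < n)%N -> 1 < p -> JN p f ->
  exists b : R, forall e : R, 0 < e -> exists a : R, forall c l,
    0 < l -> a <= l ->
    vol (cube c l) `^ p^-1 * mean (cube c l) (fun x => `|f x - b|) <= e.
Proof.
move=> n0 p1 fJN; have p0 : 0 < p by rewrite (lt_trans _ p1).
have [lf _] := fJN.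
have [b Hb] := mean_dist_far R n p f n0 p0 fJN; exists b => e e0.
have n2 : 0 < (n * 2)%:R :> R by rewrite ltr0n muln_gt0 n0.
pose e' := e / 2 / (n * 2)%:R.
have e'0 : 0 < e' by rewrite !divr_gt0.
have [M M0 HM] := Hb _ e'0.
pose I := (2 * (M + 1)) ^+ n *
    mean (cube (const_mx (- (M + 1)) : 'rV[R]_n) (2 * (M + 1)))
      (fun x => `|f x - b|).
have I0 : 0 <= I.
  by rewrite mulr_ge0 ?exprn_ge0 ?mean_ge0// mulr_ge0// addr_ge0.
pose r := 1 - p^-1.
have r0 : 0 < r by rewrite subr_gt0 invf_lt1.
(* [1 <= l] gives [l <= l ^+ n], hence [|Q|^r >= a^r]. *)
pose a := Num.max 1 ((I / (e / 2)) `^ r^-1).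
exists a => c l l0 al.
rewrite (vol_cube _ _ c l (ltW l0)); set v := l ^+ n.
have v0 : 0 < v by rewrite exprn_gt0.
have l1 : 1 <= l by rewrite (le_trans _ al)// le_max lexx.
have Iv : I / v `^ r <= e / 2.
  have e2 : 0 < e / 2 by rewrite divr_gt0.
  rewrite ler_pdivrMr ?powR_gt0// mulrC -ler_pdivrMr//.
  have -> : I / (e / 2) = ((I / (e / 2)) `^ r^-1) `^ r.
    by rewrite -powRrM mulVf ?gt_eqF// powRr1// divr_ge0// ltW.
  apply: ge0_ler_powR; rewrite ?nnegrE ?powR_ge0 ?(ltW r0) ?(ltW v0)//.
  apply: (le_trans (_ : _ <= l)).
    by rewrite (le_trans _ al)// le_max lexx orbT.
  by rewrite /v -(prednK n0) exprS ler_peMr ?(ltW l0)// exprn_ege1.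
have vr : v `^ p^-1 = v / v `^ r.
  rewrite /r powRB; last by rewrite (gt_eqF v0) implybT.
  by rewrite powRr1 ?(ltW v0)// invf_div mulrC divfK// gt_eqF.
have vd : v `^ p^-1 * decay n p l = 1.
  by rewrite /decay powRN mulfV// gt_eqF ?powR_gt0.
have H := mean_dist_cover R n f b M c l (e' * decay n p l) lf M0 l0
  (fun d => HM d l l0).
rewrite -/v -/I in H.
have {}H : v `^ p^-1 / v * (v * mean (cube c l) (fun x => `|f x - b|)) <=
    v `^ p^-1 / v * (I + (n * 2)%:R * (v * (e' * decay n p l))).
  by rewrite ler_wpM2l// divr_ge0 ?powR_ge0// ltW.
rewrite [leLHS]mulrA divfK ?gt_eqF// in H.
apply: (le_trans H); rewrite mulrDr.
have -> : v `^ p^-1 / v * I = I / v `^ r.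
  by rewrite vr (mulrAC v) mulfV ?gt_eqF// mul1r mulrC.
have -> : v `^ p^-1 / v * ((n * 2)%:R * (v * (e' * decay n p l))) = e / 2.
  transitivity ((v `^ p^-1 * decay n p l) * (v / v) * (e' * (n * 2)%:R)).
    by ring.
  by rewrite vd mulfV ?gt_eqF// !mul1r /e' divfK// gt_eqF.
by rewrite [leRHS]splitr lerD2r.
Qed.

Theorem theorem3p12 (R : realType) (n : nat) (p : R) (f : 'rV[R]_n -> R) :
  (0 < n)%N -> 1 < p -> JN p f ->
  exists b : R,
    ereal_sup [set (vol (cube z.1 z.2) `^ p^-1 *
                    mean (cube z.1 z.2) (fun x => `|f x - b|))%:E |
               z in [set z : 'rV[R]_n * R | 0 < z.2 /\ a <= z.2]]
      @[a --> +oo] --> 0%E.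
Proof.
move=> n0 p1 fJN; have [b Hb] := sup_mean_dist_small R n p f n0 p1 fJN.
exists b; set S := fun a : R => ereal_sup _.
have S0 a : (0 <= S a)%E.
  pose z : 'rV[R]_n * R := (0, Num.max 1 a).
  apply: (@le_trans _ _ (vol (cube z.1 z.2) `^ p^-1 *
    mean (cube z.1 z.2) (fun x => `|f x - b|))%:E).
    by rewrite lee_fin mulr_ge0 ?powR_ge0 ?mean_ge0.
  apply: ereal_sup_ubound; exists z => //; split; rewrite /z/=.
    by rewrite lt_max ltr01.
  by rewrite le_max lexx orbT.
have Se (e : R) : 0 < e -> \forall a \near +oo, (S a <= e%:E)%E.
  move=> e0; have [a0 Ha0] := Hb e e0.
  apply: filterS (nbhs_pinfty_ge (num_real a0)) => a aa0.
  apply: ge_ereal_sup => _ [z [z0 az] <-].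
  by rewrite lee_fin Ha0// (le_trans aa0).
have Sfin (e : R) a : (S a <= e%:E)%E -> S a \is a fin_num.
  by move=> Sa; rewrite ge0_fin_numE// (le_lt_trans Sa)// ltry.
apply/fine_cvgP; split.
  by apply: filterS (Se 1 ltr01) => a; exact: Sfin.
apply/cvgrPdist_le => e e0; apply: filterS (Se e e0) => a Sa.
rewrite sub0r normrN /= ger0_norm ?fine_ge0// -lee_fin fineK//.
exact: Sfin Sa.
Qed.
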